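(* Let $W$, $E$, $Q$, $\Phi_\lambda$, $\lambda_1$, $h(\lambda)$ be as described in the context, and assume that for every $\lambda<\lambda_1$: for any $u\in W\setminus\{0\}$ there exists a unique $t(u)=t(\lambda,u)>0$ such that $t(u)u\in\mathcal{N}_\lambda$, and $\Phi_\lambda(t(u)u)=\max_{t>0}\Phi_\lambda(tu)$. Let $c>0$. If $u$ is a normalized ground state on $S_c$ with Lagrange multiplier $\lambda<\lambda_1$, then $\Phi_\lambda(u)=h(\lambda)$. In particular, the existence of a normalized ground state under the constraint $S_c$ implies the existence of a ground state solution on the Nehari manifold $\mathcal{N}_\lambda$.
   Context: $W$ is a real Banach space and $\Phi_\lambda\in C^2(W,\mathbb{R})$, $\lambda\in\mathbb{R}$, has the form $\Phi_\lambda(u)=E(u)-\lambda Q(u)$, where $2Q(u)=D_uQ(u)(u)$ for all $u\in W$; $Q$ plays the role of the $L^2$ mass, with $Q(u)>0$ for $u\ne0$. For $c>0$, $S_c=\{u\in W:Q(u)=c\}$ and $m(c)=\inf_{u\in S_c}E(u)$. A normalized ground state on $S_c$ is a $u\in S_c$ with $E(u)=m(c)$; its Lagrange multiplier is the $\lambda\in\mathbb{R}$ with $D_uE(u)=\lambda D_uQ(u)$. The Nehari manifold is $\mathcal{N}_\lambda=\{u\in W\setminus\{0\}:D_u\Phi_\lambda(u)(u)=0\}$ and $h(\lambda)=\inf_{u\in\mathcal{N}_\lambda}\Phi_\lambda(u)$. For some $\lambda_1\in\mathbb{R}$, it is assumed that $h(\lambda)$ is well-defined and $h(\lambda)\ne0$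 for all $\lambda<\lambda_1$. A ground state solution (on $\mathcal{N}_\lambda$) is a $u\in\mathcal{N}_\lambda$ with $\Phi_\lambda(u)=h(\lambda)$. *)

(* Defs.v *)
From HB Require Import structures.
From mathcomp Require Import all_boot all_order all_algebra.
From mathcomp Require Import sesquilinear.
From mathcomp Require Import boolp classical_sets functions reals ereal topology.
From mathcomp Require Import normedtype landau derive.
Set Implicit Arguments.
Unset Strict Implicit.
Unset Printing Implicit Defensive.
Import Order.TTheory GRing.Theory Num.Theory.
Import numFieldNormedType.Exports.
Local Open Scope classical_set_scope.
Local Open Scope ring_scope.

Section C2.
Context {R : realType} {W : normedModType R}.

(* The library has no normed space of bounded linear maps, so the second
   Frechet derivative, an element of L(W, L(W, R)), is represented by a
   bounded bilinear form.  The error bounds are uniform in w (resp. in v and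
   w): they are bounds for the norm of L(W, R) (resp. of L(W, L(W, R))). *)
Definition is_diff2 (f : W -> R^o) (x : W) (B : {bilinear W -> W -> R^o}) :=
  (exists M : R, forall v w : W, `|B v w| <= M * `|v| * `|w|) /\
  (forall e : R, 0 < e -> \forall v \near (0 : W), forall w : W,
     `|'d f (x + v) w - 'd f x w - B v w| <= e * `|v| * `|w|).

Definition C2 (f : W -> R^o) : Prop :=
  (forall x : W, differentiable f x) /\
  exists D2 : W -> {bilinear W -> W -> R^o},
    (forall x : W, is_diff2 f x (D2 x)) /\
    (forall (x : W) (e : R), 0 < e -> \forall y \near x, forall v w : W,
       `|D2 y v w - D2 x v w| <= e * `|v| * `|w|).

End C2.

Section GroundStates.
Context {R : realType} {W : normedModType R}.
Implicit Types (E Q : W -> R^o) (l c : R) (u : W).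

Definition action E Q l : W -> R^o := fun u => E u - l * Q u.

Definition mass_sphere Q c : set W := [set u | Q u = c].

(* Infima are taken in \bar R: the real-valued inf has the default value 0 on
   sets that are empty or not bounded below. *)
Definition min_energy E Q c : \bar R :=
  ereal_inf [set (E u)%:E | u in mass_sphere Q c].

Definition normalized_ground_state E Q c u : Prop :=
  mass_sphere Q c u /\ (E u)%:E = min_energy E Q c.

Definition lagrange_multiplier E Q u l : Prop :=
  forall v : W, 'd E u v = l * 'd Q u v.

Definition nehari E Q l : set W :=
  [set u | u != 0 /\ 'd (action E Q l) u u = 0].

Definition nehari_level E Q l : \bar R :=
  ereal_inf [set (action E Q l u)%:E | u in nehari E Q l].

Definition nehari_ground_state E Q l u : Prop :=
  nehari E Q l u /\ (action E Q l u)%:E = nehari_level E Q l.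

Definition nehari_fibering E Q l : Prop :=
  forall u, u != 0 ->
    exists t : R,
      unique (fun s : R => 0 < s /\ nehari E Q l (s *: u)) t /\
      (forall s : R, 0 < s -> action E Q l (s *: u) <= action E Q l (t *: u)).

End GroundStates.

(* Main.v *)
Require Import Defs.
From mathcomp Require Import all_boot all_order all_algebra.
From mathcomp Require Import boolp classical_sets functions reals ereal topology.
From mathcomp Require Import normedtype landau derive sequences realfun exp.
Import Order.TTheory GRing.Theory Num.Theory.
Import numFieldNormedType.Exports.
Local Open Scope classical_set_scope.
Local Open Scope ring_scope.

(** A normalized ground state [u] is compared with a point [v] of the Nehari
manifold along the ray through [v].  Euler's identity [2 Q(w) = DQ(w)(w)] makes
[Q] homogeneous of degree two (lemma [euler_homogeneous]), so the ray through
[v] crosses the sphere [Q = c] at some [s v] with [0 < s] (lemma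
[mass_sphere_ray]).  On that sphere
the action is the energy up to the constant [- lambda c], so [u] minimizes the
action there (lemma [action_min_sphere]); and [v] itself maximizes the action
along its ray (lemma [nehari_ray_max]).  Hence
[Phi_lambda(u) <= Phi_lambda(s v) <= Phi_lambda(v)].  The multiplier equation
tested with [u] says that [u] lies on the Nehari manifold, so that the infimum
of the action over the manifold is attained at [u]. *)

(** Along the ray [expR x *: u] Euler's identity is the linear equation
[g' = k g], hence [expR (- k x) * g x] is constant.  The exponential
parametrization makes this hold on the whole real line. *)
Lemma euler_homogeneous (R : realType) (W : normedModType R) (f : W -> R^o)
    (k : R) (df : forall u, differentiable f u)
    (euler : forall u, k * f u = 'd f u u) (u : W) (s : R) :
  0 < s -> f (s *: u) = s `^ k * f u.
Proof.
move=> s_gt0; pose g : R -> R := fun x => f (expR x *: u).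
have dg (x : R) : is_derive x (1 : R) g (k * g x).
  have dexp : differentiable (expR : R -> R) x.
    by apply/derivable1_diffP; exact: derivable_expR.
  have dray : differentiable (fun y : R => expR y *: u) x.
    exact: differentiableZl.
  have dgx : differentiable (g : R -> R^o) x.
    exact: (@differentiable_comp _ _ _ _ (fun y : R => expR y *: u) f).
  apply: DeriveDef; first exact/derivable1_diffP.
  rewrite (deriveE _ dgx) (@diff_comp _ _ _ _ (fun y : R => expR y *: u) f) //=.
  have dexpE : 'd (expR : R -> R) x (1 : R) = expR x.
    by rewrite -deriveE // derive_val.
  by rewrite diffZl //= dexpE -euler.
have dG (x : R) :
    is_derive x (1 : R) ((fun y => expR (- k * y)) * g : R -> R) 0.
  have dk : is_derive x (1 : R) (fun y : R => - k * y) (- k).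
    have := is_deriveZ (- k) (is_derive_id x (1 : R)).
    by rewrite [_ *: _]mulr1.
  have dek := is_derive1_comp (is_derive_expR (- k * x)) dk.
  have := is_deriveM dek (dg x); rewrite /GRing.scale /=.
  by rewrite !mulrN [g x * _]mulrC -mulrA subrr.
have /= := is_derive_0_is_cst (ln s) 0 dG.
rewrite !fctE /g expR0 lnK ?posrE // mulr0 expR0 scale1r mul1r.
rewrite /powR gt_eqF // => <-.
by rewrite mulrA -expRD mulNr subrr expR0 mul1r.
Qed.

Section Comparison.
Context {R : realType} {W : normedModType R}.
Implicit Types (E Q : W -> R^o) (c l : R) (u v : W).

(** [E] is the action at [0], and [Q] is the difference of the actions at [0]
and [1]. *)
Lemma differentiable_energy_mass E Q :
  (forall l, C2 (action E Q l)) ->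
  forall u, differentiable E u /\ differentiable Q u.
Proof.
move=> PhiC2 u.
have [d0 _] := PhiC2 0; have [d1 _] := PhiC2 1.
have E0 : action E Q 0 = E.
  by apply/funext => w; rewrite /action mul0r subr0.
have Q01 : action E Q 0 - action E Q 1 = Q.
  apply/funext => w; rewrite -[LHS]/((E w - 0 * Q w) - (E w - 1 * Q w)).
  by rewrite mul0r mul1r subr0 opprB addrC subrK.
split; first by rewrite -E0.
by rewrite -Q01; exact: differentiableB.
Qed.

Lemma mass_sphere_ray Q c v :
  (forall s, 0 < s -> Q (s *: v) = s ^+ 2 * Q v) -> 0 < Q v -> 0 < c ->
  exists2 s, 0 < s & mass_sphere Q c (s *: v).
Proof.
move=> Q2 Qv_gt0 c_gt0; have cQ_gt0 : 0 < c / Q v by rewrite divr_gt0.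
exists (Num.sqrt (c / Q v)); first by rewrite sqrtr_gt0.
rewrite /mass_sphere /= Q2 ?sqrtr_gt0 // sqr_sqrtr ?ltW //.
by rewrite divfK ?gt_eqF.
Qed.

Lemma action_min_sphere E Q c u w l :
  normalized_ground_state E Q c u -> mass_sphere Q c w ->
  action E Q l u <= action E Q l w.
Proof.
move=> [Qu Eu] Qw; rewrite /action Qu Qw lerD2r -lee_fin Eu.
by apply: ereal_inf_lbound; exists w.
Qed.

(** The maximum along the ray is at the unique scale putting it on the Nehari
manifold, which is [1] because [v] is already there. *)
Lemma nehari_ray_max E Q l v s :
  nehari_fibering E Q l -> nehari E Q l v -> 0 < s ->
  action E Q l (s *: v) <= action E Q l v.
Proof.
move=> fib Nv s_gt0; have [t [[_ t_uniq] t_max]] := fib v Nv.1.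
have t1 : t = 1 by apply: t_uniq; rewrite scale1r.
by move: (t_max s s_gt0); rewrite t1 scale1r.
Qed.

Lemma lagrange_nehari E Q u l :
  differentiable E u -> differentiable Q u -> u != 0 ->
  lagrange_multiplier E Q u l -> nehari E Q l u.
Proof.
move=> dE dQ u0 lag; split=> //.
have -> : action E Q l = E - l *: Q by apply/funext.
by rewrite diffB ?diffZ //=; [rewrite lag subrr | exact: differentiableZ].
Qed.

End Comparison.

Theorem theoremC3 (R : realType) (W : completeNormedModType R)
    (E Q : W -> R^o) (lambda1 : R)
    (Phi_C2 : forall lambda : R, C2 (action E Q lambda))
    (Q_euler : forall u : W, 2 * Q u = 'd Q u u)
    (Q_pos : forall u : W, u != 0 -> 0 < Q u)
    (h_well_defined : forall lambda : R, lambda < lambda1 ->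
       nehari_level E Q lambda \is a fin_num)
    (h_neq0 : forall lambda : R, lambda < lambda1 ->
       nehari_level E Q lambda != 0%E)
    (fibering : forall lambda : R, lambda < lambda1 ->
       nehari_fibering E Q lambda)
    (c : R) (c_gt0 : 0 < c) :
  (forall (u : W) (lambda : R),
     normalized_ground_state E Q c u ->
     lagrange_multiplier E Q u lambda ->
     lambda < lambda1 ->
     (action E Q lambda u)%:E = nehari_level E Q lambda) /\
  (forall lambda : R, lambda < lambda1 ->
     (exists u : W, normalized_ground_state E Q c u /\
                    lagrange_multiplier E Q u lambda) ->
     exists v : W, nehari_ground_state E Q lambda v).
Proof.
have dE w : differentiable E w := (differentiable_energy_mass _ _ Phi_C2 w).1.
have dQ w : differentiable Q w := (differentiable_energy_mass _ _ Phi_C2 w).2.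
have Q2 w s : 0 < s -> Q (s *: w) = s ^+ 2 * Q w.
  move=> s_gt0.
  by rewrite (euler_homogeneous _ _ _ _ dQ Q_euler) // powR_mulrn ?ltW.
have attained u lambda : normalized_ground_state E Q c u ->
    lagrange_multiplier E Q u lambda -> lambda < lambda1 ->
    nehari_ground_state E Q lambda u.
  move=> ngs lag lt1.
  have u0 : u != 0.
    (* Euler's identity at 0 gives [Q 0 = 0], whereas [Q u = c > 0]. *)
    apply/eqP => u0; move: (Q_euler u); rewrite {-1}u0 linear0 ngs.1.
    by apply/eqP; rewrite mulf_neq0 ?gt_eqF.
  have Nu : nehari E Q lambda u by exact: lagrange_nehari.
  split=> //; apply/eqP; rewrite eq_le; apply/andP; split; last first.
    by apply: ereal_inf_lbound; exists u.
  apply: le_ereal_inf_tmp => _ [v Nv <-]; rewrite lee_fin.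
  have [s s_gt0 Qsv] := mass_sphere_ray _ _ _ (Q2 v) (Q_pos _ Nv.1) c_gt0.
  apply: le_trans (nehari_ray_max _ _ _ _ _ (fibering _ lt1) Nv s_gt0).
  exact: action_min_sphere ngs Qsv.
split=> [u lambda ngs lag lt1|lambda lt1 [u [ngs lag]]].
  exact: (attained u lambda ngs lag lt1).2.
by exists u; exact: attained.
Qed.
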